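(* (1) Let $\mathbb{P}$ be a joint distribution of random variables $(X_1,\dots,X_p)$ and $G^*$ a DAG on $[p]$ such that $(G^*,\mathbb{P})$ satisfies the Markov property. If $\mathbb{P}$ satisfies the restricted-faithfulness assumption with respect to $G^*$, then $(G^*,\mathbb{P})$ satisfies the sparsest Markov representation (SMR) assumption. (2) There exist pairs $(G^*,\mathbb{P})$ (satisfying the Markov property) that satisfy the SMR assumption but not the restricted-faithfulness assumption.
   Context: $[p]=\{1,\dots,p\}$. A DAG $G=([p],E)$ is a directed acyclic graph; $|G|$ is its number of edges; its skeleton is the underlying undirected graph. $(G,\mathbb{P})$ satisfies the Markov property ($\mathbb{P}$ is Markov to $G$) if every d-separation statement of $G$ holds as a conditional independence relation in $\mathbb{P}$. Two DAGs are Markov equivalent if they have the same d-separation statements; $\mathcal{M}(G)$ is the Markov equivalence class of $G$. Restricted-faithfulness of $\mathbb{P}$ with respect to $G=([p],E)$: $\mathbb{P}$ is Markov to $G$ and the following hold. (i) Adjacency-faithfulness: for all $(j,k)\in E$ and all $S\subset[p]\setminus\{j,k\}$, $X_j$ and $X_k$ are not conditionally independent given $X_S$. (ii) Orientation-faithfulness: for all triples $(j,k,\ell)$ with skeleton $j-\ell-k$ (that is, $\ell$ is adjacent to both $j$ and $k$, and $j,k$ are not adjacent) and all $S\subset[p]\setminus\{j,k\}$ such that $j$ is d-connected to $k$ given $S$ in $G$, $X_j$ and $X_k$ are not conditionally independent given $X_S$. SMR assumption: $(G^*,\mathbb{P})$ satisfies the Markov property and $|G|>|G^*|$ for every DAG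 $G$ on $[p]$ such that $(G,\mathbb{P})$ satisfies the Markov property and $G\notin\mathcal{M}(G^* )$. *)

(* Defs.v *)
From HB Require Import structures.
From mathcomp Require Import all_boot all_order all_algebra.
From mathcomp Require Import all_classical all_reals all_analysis.

Set Implicit Arguments.
Unset Strict Implicit.
Unset Printing Implicit Defensive.

Import Order.TTheory GRing.Theory Num.Theory.

Local Open Scope classical_set_scope.
Local Open Scope ring_scope.

(* The vertex set [p] = {1, ..., p} is 'I_p. *)

Record dag (p : nat) := Dag {
  arcs : {set 'I_p * 'I_p} ;
  (* [path.cycle] reads [:: x_0; ...; x_n] as x_0 -> ... -> x_n -> x_0, so this
     excludes loops and 2-cycles as well as longer directed cycles. *)
  _ : forall c : seq 'I_p, c != [::] -> ~~ cycle (fun x y : 'I_p => (x, y) \in arcs) c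
}.

Section DagDefs.
Variable p : nat.
Implicit Types (G : dag p) (A B S : {set 'I_p}) (j k l x y : 'I_p).

Definition arc_rel G : rel 'I_p := fun x y => (x, y) \in arcs G.

Definition num_edges G : nat := #|arcs G|.

Definition dag_adjacent G : rel 'I_p := fun x y => arc_rel G x y || arc_rel G y x.

(* y = x is allowed: this is "y is x or a descendant of x". *)
Definition descendant_or_self G : rel 'I_p := connect (arc_rel G).

(* An interior vertex v of a path, with neighbours u and w on that path, lets
   the path through given S: a collider u -> v <- w must be in S or have a
   descendant in S, any other v must lie outside S. *)
Definition open_triple G S (u v w : 'I_p) : bool :=
  if arc_rel G u v && arc_rel G w v
  then [exists x in S, descendant_or_self G v x]
  else v \notin S.

Fixpoint open_path G S (q : seq 'I_p) : bool :=
  match q with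
  | u :: ((v :: w :: _) as q') => open_triple G S u v w && open_path G S q'
  | _ => true
  end.

Definition d_connected G j k S : Prop :=
  exists q : seq 'I_p,
    [/\ path (dag_adjacent G) j q, uniq (j :: q), last j q = k
      & open_path G S (j :: q)].

Definition d_separated G A B S : Prop :=
  forall j k, j \in A -> k \in B -> ~ d_connected G j k S.

Definition pairwise_disjoint3 A B S : bool :=
  [&& [disjoint A & B], [disjoint A & S] & [disjoint B & S]].

Definition markov_equivalent G G' : Prop :=
  forall A B S, pairwise_disjoint3 A B S ->
    (d_separated G A B S <-> d_separated G' A B S).

End DagDefs.

Section ConditionalIndependence.
Context d (T : measurableType d) (R : realType) (P : probability T R).

(* f is a version of the conditional probability P(E | F), for a sub-sigma-
   algebra F of the measurable sets. *)
Definition is_cond_prob (F : set (set T)) (E : set T) (f : T -> R) : Prop :=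
  [/\ g_sigma_algebra_preimage f `<=` F,
      P.-integrable setT (EFin \o f)
    & forall D, F D -> (\int[P]_(w in D) (f w)%:E = P (E `&` D))%E].

(* P(E1 `&` E2 | H) = P(E1 | H) P(E2 | H) almost surely for all E1 in F1 and
   E2 in F2. Conditional probabilities exist (Radon-Nikodym) and are unique up
   to almost sure equality, so the choice of versions is immaterial. *)
Definition cond_indep_sigma (F1 F2 H : set (set T)) : Prop :=
  forall E1 E2, F1 E1 -> F2 E2 ->
  exists f1 f2 f12 : T -> R,
    [/\ is_cond_prob H E1 f1, is_cond_prob H E2 f2,
        is_cond_prob H (E1 `&` E2) f12
      & {ae P, forall w, f12 w = f1 w * f2 w}].

Context (p : nat) (d' : 'I_p -> measure_display)
  (V : forall i, measurableType (d' i)) (X : forall i, {RV P >-> V i}).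

(* sigma(X_i : i in A), the sigma-algebra generated by the subvector X_A; it
   is trivial for A empty. *)
Definition sigma_rv (A : {set 'I_p}) : set (set T) :=
  <<s \bigcup_(i in [set` A]) g_sigma_algebra_preimage (X i) >>.

Definition cond_indep (A B S : {set 'I_p}) : Prop :=
  cond_indep_sigma (sigma_rv A) (sigma_rv B) (sigma_rv S).

Definition markov_property (G : dag p) : Prop :=
  forall A B S : {set 'I_p}, pairwise_disjoint3 A B S ->
    d_separated G A B S -> cond_indep A B S.

Definition adjacency_faithful (G : dag p) : Prop :=
  forall (j k : 'I_p) (S : {set 'I_p}),
    arc_rel G j k -> j \notin S -> k \notin S ->
    ~ cond_indep [set j]%SET [set k]%SET S.

Definition orientation_faithful (G : dag p) : Prop :=
  forall (j k l : 'I_p) (S : {set 'I_p}),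
    j != k -> dag_adjacent G j l -> dag_adjacent G l k -> ~~ dag_adjacent G j k ->
    j \notin S -> k \notin S -> d_connected G j k S ->
    ~ cond_indep [set j]%SET [set k]%SET S.

Definition restricted_faithful (G : dag p) : Prop :=
  [/\ markov_property G, adjacency_faithful G & orientation_faithful G].

Definition smr (Gstar : dag p) : Prop :=
  markov_property Gstar /\
  forall G : dag p, markov_property G -> ~ markov_equivalent Gstar G ->
    (num_edges Gstar < num_edges G)%N.

End ConditionalIndependence.

(* Main.v *)
Require Import Defs.
From HB Require Import structures.
From mathcomp Require Import all_boot all_order all_algebra.
From mathcomp Require Import all_classical all_reals all_analysis.

(** Why the theorem holds.

    Restricted faithfulness implies sparsity. Let the distribution be Markov
    to a DAG [G]. Two vertices that are not adjacent in [G] are d-separated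
    by the parents of one of them ([nonadjacent_separated]), so they are
    conditionally independent; adjacency-faithfulness then forces every edge
    of [Gstar] to be an edge of [G], up to direction, whence
    [num_edges Gstar <= num_edges G]. If the edge counts agree, the
    skeletons agree ([skeleton_num_edges]). Consider then a triple
    [j - l - k] with [j], [k] not adjacent, and a set [S] separating [j] from
    [k] in [G]. The triple is a collider exactly when [l] is outside [S]
    ([separator_collider]), and by orientation-faithfulness the same [S]
    separates [j] from [k] in [Gstar], so the triple is a collider in both
    graphs or in neither. Equal skeletons and equal unshielded colliders give
    Markov equivalence ([same_colliders_markov_equivalent], the theorem of
    Verma and Pearl); hence a DAG outside the equivalence class has strictly
    more edges.

    The Verma-Pearl theorem is proved by minimizing. Weigh a trail by the sum,
    over its vertices, of the number of their descendants. Deleting vertices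
    or replacing a vertex by one of its children lowers the weight. An open
    trail of least weight therefore admits no open shortcut, which forces all
    its colliders to be unshielded and determines enough arrows around its
    shielded non-colliders for the very same trail to be open in the other
    graph ([minimal_trail_transfer]).

    The converse fails. Take [0 -> 1 -> 3] and [0 -> 2 -> 3], with [u] uniform
    on three values, [c] and [d] independent fair bits, [X0 = u],
    [X1 = (u = 0, c)], [X2 = (u = 1, d)] and [X3 = c && d]. Adjacent variables
    are dependent given anything, so a sparser or equally sparse Markov DAG
    has the same skeleton; [X1] and [X2] are independent only given [X0]
    alone, which pins down the unshielded colliders, so SMR holds. But [X0]
    and [X3] are marginally independent although [0 -> 1 -> 3] is open.
    Since [u], [c], [d] are encoded by twelve equally likely integers, each of
    these claims about conditional independence is a product rule between
    cardinalities ([cond_indep_of_counts], [cond_indep_counts]), decided by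
    computation. *)

Set Implicit Arguments.
Unset Strict Implicit.
Unset Printing Implicit Defensive.

Import Order.TTheory GRing.Theory Num.Theory.

(** * Arcs and open trails *)

Section Arcs.
Context {p : nat}.
Implicit Types (G : dag p) (S : {set 'I_p}) (u v w x y z : 'I_p).

Lemma arc_connect_acyclic G x y :
  arc_rel G x y -> connect (arc_rel G) y x -> False.
Proof.
move=> xy /connectP[s ys xE]; case: G xy ys => E acE xy ys.
have /negP := acE (y :: s) isT; apply.
by rewrite /= rcons_path; apply/andP; split; rewrite // -xE.
Qed.

Lemma arc_asym G x y : arc_rel G x y -> arc_rel G y x = false.
Proof. by move=> xy; apply/negP => /connect1; apply: arc_connect_acyclic. Qed.

Lemma arc_irrefl G x : arc_rel G x x = false.
Proof. by apply/negP => xx; move: (arc_asym xx); rewrite xx. Qed.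

Lemma dag_adjacent_sym G x y : dag_adjacent G x y = dag_adjacent G y x.
Proof. by rewrite /dag_adjacent orbC. Qed.

Lemma arc_adjacent G x y : arc_rel G x y -> dag_adjacent G x y.
Proof. by rewrite /dag_adjacent => ->. Qed.

Lemma dag_adjacent_neq G x y : dag_adjacent G x y -> x != y.
Proof. by apply: contraL => /eqP->; rewrite /dag_adjacent arc_irrefl. Qed.

Lemma adjacent_arc G x y :
  dag_adjacent G x y -> arc_rel G x y = false -> arc_rel G y x.
Proof. by rewrite /dag_adjacent => + xy; rewrite xy. Qed.

Lemma arc_trans_adjacent G x y z :
  arc_rel G x y -> arc_rel G y z -> dag_adjacent G x z -> arc_rel G x z.
Proof.
move=> xy yz /orP[//|zx]; case: (@arc_connect_acyclic G z x zx).
exact: connect_trans (connect1 xy) (connect1 yz).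
Qed.

(** The activation condition of a collider [v]. *)
Definition reaches G S v := [exists x in S, descendant_or_self G v x].

Lemma reaches_mem G S v : v \in S -> reaches G S v.
Proof. by move=> vS; apply/exists_inP; exists v => //; apply: connect0. Qed.

Lemma reaches_arc G S v w : arc_rel G v w -> reaches G S w -> reaches G S v.
Proof.
move=> vw /exists_inP[x xS wx]; apply/exists_inP; exists x => //.
exact: connect_trans (connect1 vw) wx.
Qed.

Lemma open_triple_sym G S u v w : open_triple G S u v w = open_triple G S w v u.
Proof. by rewrite /open_triple andbC. Qed.

Lemma open_tripleE G S u v w : open_triple G S u v w =
  if arc_rel G u v && arc_rel G w v then reaches G S v else v \notin S.
Proof. by []. Qed.

Lemma open_path_split G S a u v b : open_path G S (a ++ u :: v :: b) =
  open_path G S (a ++ [:: u; v]) && open_path G S (u :: v :: b).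
Proof.
elim: a => [//|x [|y a] IH]; first by rewrite /= andbT.
case: a IH => [|z a] IH; first by rewrite /= andbT in IH *; rewrite andbA.
by move: IH; rewrite !cat_cons /= => ->; rewrite andbA.
Qed.

Lemma open_path_rev G S q : open_path G S (rev q) = open_path G S q.
Proof.
elim: q => [//|x [|y [|z q]]] IH //.
rewrite !rev_cons -!cats1 -!catA /= open_path_split.
move: IH; rewrite !rev_cons -!cats1 -!catA /= => ->.
by rewrite andbT andbC open_triple_sym.
Qed.

Lemma open_pathP G S q :
  (forall a u v w b, q = a ++ u :: v :: w :: b -> open_triple G S u v w) <->
  open_path G S q.
Proof.
split=> [|qo a u v w b qE].
  elim: q => [//|x [|y [|z q]]] IH // H.
  apply/andP; split; first exact: (H [::] _ _ _ q).
  by apply: IH => a u v w b qE; apply: (H (x :: a) _ _ _ b); rewrite qE.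
by move: qo; rewrite qE open_path_split /= => /and3P[].
Qed.

(** Both endpoints are read off the whole sequence, so that the notion is
    symmetric under reversal, unlike the split of a path into head and tail. *)
Definition open_trail G S j k q :=
  [/\ sorted (dag_adjacent G) q, uniq q, open_path G S q,
      ohead q = Some j & ohead (rev q) = Some k].

Lemma d_connectedE G j k S :
  d_connected G j k S <-> exists q, open_trail G S j k q.
Proof.
split=> [[q [jq uq qk oq]]|[[|i q] [jq uq oq //= [ij] qk]]].
  exists (j :: q); split=> //.
  by case: (lastP q) qk => [/= ->//|s x]; rewrite last_rcons -rcons_cons rev_rcons => ->.
subst i; exists q; split=> //.
by case: (lastP q) qk => [/= [->]//|s x]; rewrite last_rcons -rcons_cons rev_rcons => -[].
Qed.

Lemma open_trail_rev G S j k q :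
  open_trail G S j k q -> open_trail G S k j (rev q).
Proof.
move=> [sq uq oq hq lq]; split; rewrite ?rev_uniq ?open_path_rev ?revK //.
rewrite rev_sorted (eq_sorted (e' := dag_adjacent G)) // => x y.
exact: dag_adjacent_sym.
Qed.

Lemma d_connected_sym G j k S : d_connected G j k S -> d_connected G k j S.
Proof.
by move=> /d_connectedE[q /open_trail_rev qo]; apply/d_connectedE; exists (rev q).
Qed.

Lemma open_trail_triple G S j k a u v w b :
  open_trail G S j k (a ++ u :: v :: w :: b) -> open_triple G S u v w.
Proof. by move=> [_ _ /open_pathP + _ _]; apply. Qed.

Lemma open_trail_adj G S j k a u v b :
  open_trail G S j k (a ++ u :: v :: b) -> dag_adjacent G u v.
Proof. by move=> [+ _ _ _ _]; rewrite sorted_cat_cons /= => /and3P[]. Qed.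

(** Local surgery on an open trail: only the triples that meet the new segment
    have to be rechecked. The two outermost of them are centred at [u] and at
    [w], whose outer neighbours exist unless [u] or [w] is an end of the
    trail, in which case there is no condition. *)
Lemma open_trail_substitute G S j k a u m m' w b :
  open_trail G S j k (a ++ u :: m ++ w :: b) ->
  uniq (a ++ u :: m' ++ w :: b) ->
  path (dag_adjacent G) u (rcons m' w) ->
  open_path G S (u :: rcons m' w) ->
  (forall a' t, a = rcons a' t -> open_triple G S t u (head w m')) ->
  (forall x b', b = x :: b' -> open_triple G S (last u m') w x) ->
  open_trail G S j k (a ++ u :: m' ++ w :: b).
Proof.
move=> [sq uq oq hq lq] uq' sm om opa opb; split=> //.
- move: sq; rewrite !sorted_cat_cons => /andP[-> /=].
  by rewrite -!cat_rcons !cat_path !last_rcons sm => /andP[].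
- have oa : open_path G S (a ++ [:: u; head w m']).
    case: (lastP a) opa oq => [//|a' t] opa; rewrite !cat_rcons => oq.
    rewrite open_path_split /= (opa _ _ erefl) !andbT.
    by move: oq; rewrite open_path_split => /andP[].
  have ob : open_path G S (last u m' :: w :: b).
    case: b opb oq {hq lq sq uq uq'} => [//|x b'] opb oq.
    rewrite /= (opb _ _ erefl) /=.
    by move: oq; rewrite -cat_cons catA open_path_split => /andP[].
  have -> : a ++ u :: m' ++ w :: b =
     (a ++ belast u m') ++ last u m' :: w :: b.
    by rewrite -!catA; congr (_ ++ _); rewrite -cat_cons lastI cat_rcons.
  rewrite open_path_split ob andbT -catA -cat_rcons -lastI cat_cons.
  case: m' {uq' sm opa opb ob} om oa => [//|x m'] om oa.
  by rewrite /= open_path_split oa -cat_rcons cats0.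
- by move: hq; case: (a).
- have E n : rev (a ++ u :: n ++ w :: b) = rev b ++ w :: rev (a ++ u :: n).
    by rewrite -cat_cons catA rev_cat rev_cons cat_rcons.
  by move: lq; rewrite !E; case: (rev b).
Qed.

End Arcs.

(** * Minimal open trails and Markov equivalence *)

Section Minimal.
Context {p : nat}.
Implicit Types (G : dag p) (S : {set 'I_p}) (u v w x y z : 'I_p).

Definition num_desc G v := #|[pred x | descendant_or_self G v x]|.

Lemma num_desc_gt0 G v : (0 < num_desc G v)%N.
Proof. by apply/card_gt0P; exists v; rewrite inE; apply: connect0. Qed.

Lemma num_desc_arc G v w : arc_rel G v w -> (num_desc G w < num_desc G v)%N.
Proof.
move=> vw; apply/proper_card/properP; split.
  by apply/fintype.subsetP => x; rewrite !inE; apply/connect_trans/connect1.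
exists v; rewrite inE; first exact: connect0.
by apply/negP => /(arc_connect_acyclic vw).
Qed.

(** Every surgery below lowers this weight: deletion because each vertex is its
    own descendant, descent to a child because the child has strictly fewer
    descendants. *)
Definition trail_weight G (q : seq 'I_p) := (\sum_(v <- q) num_desc G v)%N.

Definition minimal_trail G S j k q := open_trail G S j k q /\
  forall q', open_trail G S j k q' -> (trail_weight G q <= trail_weight G q')%N.

Lemma minimal_trail_exists G S j k q :
  open_trail G S j k q -> exists q', minimal_trail G S j k q'.
Proof.
have [n] := ubnP (trail_weight G q); elim: n q => // n IH q /ltnSE qn oq.
have [qmin|] := pselect (forall q', open_trail G S j k q' ->
   (trail_weight G q <= trail_weight G q')%N); first by exists q.
move=> /existsNP[q' /not_implyP[oq' /negP]]; rewrite -ltnNge => q'q.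
by apply: IH oq'; apply: leq_trans q'q qn.
Qed.

Lemma minimal_trail_rev G S j k q :
  minimal_trail G S j k q -> minimal_trail G S k j (rev q).
Proof.
have revw s : trail_weight G (rev s) = trail_weight G s.
  by apply/perm_big; rewrite perm_rev.
move=> [oq qmin]; split=> [|q' oq']; first exact: open_trail_rev.
by rewrite revw -(revw q'); apply/qmin/open_trail_rev.
Qed.

Lemma trail_weight_splice G a u m m' w b :
  (trail_weight G (a ++ u :: m ++ w :: b) <= trail_weight G (a ++ u :: m' ++ w :: b))%N =
  (trail_weight G m <= trail_weight G m')%N.
Proof.
rewrite /trail_weight !(big_cat, big_cons) /=.
by rewrite !leq_add2l leq_add2r.
Qed.

Lemma minimal_no_shortcut G S j k a u x m w b :
  minimal_trail G S j k (a ++ u :: x :: m ++ w :: b) ->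
  dag_adjacent G u w ->
  (forall a' t, a = rcons a' t -> open_triple G S t u w) ->
  (forall y b', b = y :: b' -> open_triple G S u w y) -> False.
Proof.
rewrite -(cat_cons x) => -[oq qmin] uw opa opb.
have /qmin : open_trail G S j k (a ++ u :: [::] ++ w :: b).
  apply: (open_trail_substitute oq) => //=; last by rewrite uw.
  case: oq => _ + _ _ _; apply: subseq_uniq.
  apply: cat_subseq => //; apply: (@cat_subseq _ [:: u] _ (u :: x :: m)) => //.
  by rewrite sub1seq mem_head.
rewrite trail_weight_splice /trail_weight big_nil big_cons leqn0 addn_eq0.
by rewrite eqn0Ngt num_desc_gt0.
Qed.

Lemma trail_neq G S j k a u m w b :
  open_trail G S j k (a ++ u :: m ++ w :: b) -> u != w.
Proof.
move=> [_ + _ _ _]; rewrite cat_uniq /= mem_cat in_cons => /and4P[_ _ + _].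
by rewrite !negb_or => /and3P[].
Qed.

Lemma open_triple_tail G S t u v w :
  arc_rel G u v -> arc_rel G u w ->
  open_triple G S t u v = open_triple G S t u w.
Proof. by move=> uv uw; rewrite !open_tripleE !(arc_asym uv, arc_asym uw) !andbF. Qed.

Lemma open_triple_head G S u v v' w :
  arc_rel G v u -> arc_rel G v' u ->
  open_triple G S v u w = open_triple G S v' u w.
Proof. by move=> vu v'u; rewrite !open_tripleE vu v'u. Qed.

(** Leaving [u] along an arrow out of [u], before as well as after the shortcut,
    keeps the status of [u]: only the far end has to be checked. *)
Lemma minimal_tail_shortcut G S j k a u x m w b :
  minimal_trail G S j k (a ++ u :: x :: m ++ w :: b) ->
  arc_rel G u x -> arc_rel G u w ->
  (forall y b', b = y :: b' -> open_triple G S u w y) -> False.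
Proof.
move=> qmin ux uw; apply: (minimal_no_shortcut qmin); first exact: arc_adjacent.
move=> a' t aE; rewrite -(open_triple_tail S t ux uw).
by case: qmin => [+ _]; rewrite aE cat_rcons => /open_trail_triple.
Qed.


(** If the trail meets later a child [d] of [u] from which [S] is reachable,
    jumping from [u] to [d] is a legal shortcut: either [d] becomes an active
    collider, or it has an outgoing arrow, in which case it was already a
    non-collider of the trail. *)
Lemma minimal_no_jump_forward G S j k a u v m d b :
  minimal_trail G S j k (a ++ u :: v :: m ++ d :: b) ->
  arc_rel G u v -> arc_rel G u d -> reaches G S d -> False.
Proof.
move=> qmin uv ud dS; apply: (minimal_tail_shortcut qmin) => // y b' bE.
rewrite open_tripleE ud; case: ifPn => //= yd.
have [oq _] := qmin; move: oq.
rewrite bE -cat_cons [v :: m]lastI cat_rcons -cat_cons catA => /open_trail_triple.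
by rewrite open_tripleE (negbTE yd) andbF.
Qed.

Lemma minimal_no_jump_backward G S j k a d m v u b :
  minimal_trail G S j k (a ++ d :: m ++ v :: u :: b) ->
  arc_rel G u v -> arc_rel G u d -> reaches G S d -> False.
Proof.
move=> /minimal_trail_rev qmin.
apply: (@minimal_no_jump_forward _ _ k j (rev b) u v (rev m) d (rev a)).
by move: qmin; rewrite rev_cat !rev_cons rev_cat !rev_cons -!cats1 -!catA.
Qed.

(** Were [u] and [w] joined by an arrow, say [u -> w], then [w -> v] would lead
    from [w] to [S], and one could jump from [u] to [w]. *)
Lemma minimal_collider_unshielded G S j k a u v w b :
  minimal_trail G S j k (a ++ [:: u, v, w & b]) ->
  arc_rel G u v -> arc_rel G w v -> ~~ dag_adjacent G u w.
Proof.
move=> qmin uv wv; apply/negP => uw.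
have vS : reaches G S v.
  by case: qmin => /open_trail_triple + _; rewrite open_tripleE uv wv.
case/orP: uw => [uw|wu].
  by apply: (@minimal_no_jump_forward G S j k a u v [::] w b); rewrite // (reaches_arc wv).
by apply: (@minimal_no_jump_backward G S j k a u [::] v w b); rewrite // (reaches_arc uv).
Qed.

(** Otherwise the collider [v] could slide down to its child [d], which gives a
    lighter trail; if [d] already lies on the trail, jumping to it is a
    shortcut. *)
Lemma minimal_collider_child G S j k a u v w b d :
  minimal_trail G S j k (a ++ [:: u, v, w & b]) ->
  arc_rel G u v -> arc_rel G w v -> arc_rel G v d ->
  dag_adjacent G u d -> dag_adjacent G w d -> ~~ reaches G S d.
Proof.
move=> qmin uv wv vd uda wda; apply/negP => dS.
have ud := arc_trans_adjacent uv vd uda.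
have wd := arc_trans_adjacent wv vd wda.
have du : d != u by rewrite eq_sym (dag_adjacent_neq uda).
have dv : d != v by rewrite eq_sym (dag_adjacent_neq (arc_adjacent vd)).
have dw : d != w by rewrite eq_sym (dag_adjacent_neq wda).
have [da|da] := boolP (d \in a).
  case/splitPr: da qmin => a1 a2 qmin.
  apply: (@minimal_no_jump_backward G S j k a1 d (rcons a2 u) v w b) => //.
  by rewrite cat_rcons -cat_cons catA.
have [db|db] := boolP (d \in b).
  case/splitPr: db qmin => b1 b2 qmin.
  exact: (@minimal_no_jump_forward G S j k a u v (w :: b1) d b2).
have [oq /(_ (a ++ u :: [:: d] ++ w :: b))] := qmin.
rewrite (trail_weight_splice G a u [:: v] [:: d]) /trail_weight !big_seq1.
rewrite leqNgt num_desc_arc // => contra; apply: notF; apply: contra.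
apply: (@open_trail_substitute _ _ _ _ _ a u [:: v] [:: d]) => //=.
- case: oq => _ + _ _ _.
  rewrite !cat_uniq /= !inE !negb_or.
  rewrite da db (eq_sym u d) du dw /= => /andP[-> /andP[/and4P[-> _ -> ->]]].
  by move=> /andP[/and3P[_ -> ->] /andP[_ /andP[-> ->]]].
- by rewrite uda dag_adjacent_sym wda.
- by rewrite open_tripleE ud wd dS.
- move=> a' t aE; rewrite -(open_triple_tail S t uv ud).
  by move: oq; rewrite aE cat_rcons => /open_trail_triple.
move=> x b' bE; rewrite open_triple_sym -(open_triple_tail S x wv wd) open_triple_sym.
by move: oq; rewrite bE -cat_rcons => /open_trail_triple.
Qed.

Section Transfer.
Context (G H : dag p).
Context (same_skeleton : dag_adjacent G =2 dag_adjacent H).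
Context (same_colliders : forall u v w, u != w -> ~~ dag_adjacent G u w ->
  arc_rel G u v && arc_rel G w v = arc_rel H u v && arc_rel H w v).

(** The chain [u -> v -> w] is an unshielded non-collider of [G], hence of [H],
    where [u -> v] then forces [v -> w]. *)
Lemma unshielded_arc u v w :
  arc_rel G u v -> arc_rel H u v -> arc_rel G v w -> u != w ->
  ~~ dag_adjacent G u w -> arc_rel H v w.
Proof.
move=> uvG uvH vw neq_uw nuw.
have := same_colliders v neq_uw nuw; rewrite uvG uvH (arc_asym vw) /= => wv.
apply: (@adjacent_arc p H w v) => //.
by rewrite -same_skeleton dag_adjacent_sym arc_adjacent.
Qed.


(** Follow a directed path of [G] from the collider [u -> v <- w] to [S]. Its
    arrows keep their direction in [H] as long as the path is unshielded. A
    shielding edge inside the path shortens it, and a shielding edge at [v]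
    can be avoided unless the next vertex is adjacent to both [u] and [w]. *)
Lemma reaches_transfer S u w v :
  arc_rel G u v -> arc_rel H u v -> arc_rel G w v -> arc_rel H w v ->
  reaches G S v -> reaches H S v \/
  exists d, [/\ arc_rel G v d, dag_adjacent G u d, dag_adjacent G w d & reaches G S d].
Proof.
move=> uvG uvH wvG wvH /exists_inP[x xS /connectP[s vs xE]].
suff [|[d [s' [vd ud wd /andP[ds' s'S] _]]]] : reaches H S v \/ exists d s',
    [/\ arc_rel G v d, dag_adjacent G u d, dag_adjacent G w d,
        path (arc_rel G) d s' && (last d s' \in S) & (size s' < size s)%N].
- by left.
- right; exists d; split=> //; apply/exists_inP; exists (last d s') => //.
  by apply/connectP; exists s'.
rewrite {}xE in xS.
have [n] := ubnP (size s); elim: n s u w v uvG uvH wvG wvH vs xS => // n IH s u w v.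
case: s => [|d s] uvG uvH wvG wvH /=.
  by move=> _ vS _; left; apply: reaches_mem.
move=> /andP[vd ds] sS; rewrite ltnS => sn.
have [/andP[ud wd]|nad] := boolP (dag_adjacent G u d && dag_adjacent G w d).
  by right; exists d, s; rewrite ds sS.
have vdH : arc_rel H v d.
  have neq z : arc_rel G z v -> z != d.
    by move=> zv; apply: contraTneq zv => ->; rewrite (arc_asym vd).
  case/nandP: nad; first exact: unshielded_arc uvG uvH vd (neq _ uvG).
  exact: unshielded_arc wvG wvH vd (neq _ wvG).
have [dS|[e [s' [de ve _ /andP[es' s'S] s's]]]] := IH s v v d vd vdH vd vdH ds sS sn.
  by left; apply: reaches_arc dS.
have ves' : path (arc_rel G) v (e :: s') by rewrite /= es' (arc_trans_adjacent vd).
have [||] := IH (e :: s') u w v uvG uvH wvG wvH ves' s'S.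
- exact: leq_trans sn.
- by left.
move=> [e' [s'' [? ? ? ? s''s]]]; right; exists e', s''; split=> //.
by apply: leq_trans s''s _; rewrite /= ltnW.
Qed.

(** The shortcut [u - w] is blocked at [u] only if [u] is a collider in [S], so
    that [t -> u <- v -> w] and [u -> w]. Here [t] is adjacent neither to [v]
    nor to [w], else a shortcut from [t] would be open. Therefore
    [t -> u <- v] is an unshielded collider and persists in [H], whence
    [u -> w] and then [v -> w] in [H]. *)
Lemma minimal_shielded_noncollider S j k a t u v w b :
  minimal_trail G S j k (rcons a t ++ [:: u, v, w & b]) ->
  ~~ (arc_rel G u v && arc_rel G w v) -> dag_adjacent G u w ->
  ~~ open_triple G S t u w -> arc_rel H v w.
Proof.
move=> qmin nc uw; have [oq _] := qmin.
have vS : v \notin S by move: (open_trail_triple oq); rewrite open_tripleE (negbTE nc).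
have vw : dag_adjacent G v w by move: oq; rewrite -cat_rcons => /open_trail_adj.
rewrite cat_rcons in qmin oq.
have uv : dag_adjacent G u v by move: oq; rewrite -cat_rcons => /open_trail_adj.
have tu := open_trail_adj oq.
have := open_trail_triple oq; rewrite !open_tripleE.
case: ifPn => [/andP[tuG vuG] uS|tuv uS]; last first.
  case: ifPn => [/andP[tuG wuG] _|_]; last by rewrite uS.
  rewrite tuG /= in tuv; have uvG : arc_rel G u v.
    by apply: (@adjacent_arc p G v u); rewrite 1?dag_adjacent_sym ?(negbTE tuv).
  have wvG : arc_rel G w v by apply: arc_trans_adjacent wuG uvG _; rewrite dag_adjacent_sym.
  by rewrite uvG wvG in nc.
rewrite uS tuG /=; case: ifPn => // wu; rewrite negbK => {}uS.
have uwG : arc_rel G u w.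
  by apply: (@adjacent_arc p G w u); rewrite 1?dag_adjacent_sym ?(negbTE wu).
have vwG := arc_trans_adjacent vuG uwG vw.
(* An edge t - w would be t -> w, and t could jump over u and v. *)
have ntw : ~~ dag_adjacent G t w.
  apply/negP => tw; have twG := arc_trans_adjacent tuG uwG tw.
  apply: (@minimal_tail_shortcut G S j k a t u [:: v] w b) => // y b' bE.
  rewrite -(open_triple_head S y vwG twG).
  by move: oq; rewrite bE -2!cat_rcons => /open_trail_triple.
(* With an edge t - v, skipping u would be open whatever its direction: if
   t becomes a collider, it is active because of t -> u with u in S. *)
have ntv : ~~ dag_adjacent G t v.
  apply/negP => tv; apply: (@minimal_no_shortcut G S j k a t u [::] v (w :: b)) => //.
    move=> a' s aE; rewrite open_tripleE; case: ifPn => _.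
      by apply: (reaches_arc tuG); apply: reaches_mem.
    move: oq; rewrite aE cat_rcons => /open_trail_triple.
    by rewrite open_tripleE (arc_asym tuG) andbF.
  by move=> y b' [<- _]; rewrite open_tripleE (arc_asym vwG) andbF.
have tv : t != v := @trail_neq G S j k a t [:: u] v _ oq.
have tw : t != w := @trail_neq G S j k a t [:: u; v] w _ oq.
have := same_colliders u tv ntv; rewrite tuG vuG => /esym/andP[tuH vuH].
have uwH := unshielded_arc tuG tuH uwG tw ntw.
by apply: arc_trans_adjacent vuH uwH _; rewrite -same_skeleton.
Qed.

(** A least-weight trail is open in [H]: its colliders are unshielded, hence
    colliders of [H], and still active there since they have no child to slide
    to; its unshielded non-colliders are preserved, and a shielded one cannot
    become a collider because one of its two arrows points outwards in [H]. *)
Lemma minimal_trail_transfer S j k q :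
  minimal_trail G S j k q -> open_trail H S j k q.
Proof.
move=> qmin; have [oq _] := qmin; have [sq uq _ hq lq] := oq.
split=> //; first by rewrite -(eq_sorted same_skeleton).
apply/open_pathP => a u v w b qE; rewrite {}qE in qmin oq {sq uq hq lq}.
have := open_trail_triple oq; rewrite !open_tripleE.
have uw : u != w := @trail_neq G S j k a u [:: v] w b oq.
case: ifPn => [/andP[uvG wvG] vS|nc vS].
  have nuw := minimal_collider_unshielded qmin uvG wvG.
  have := same_colliders v uw nuw; rewrite uvG wvG => /esym/andP[uvH wvH].
  rewrite uvH wvH /=; have [//|[d [vd ud wd dS]]] := reaches_transfer uvG uvH wvG wvH vS.
  by have := minimal_collider_child qmin uvG wvG vd ud wd; rewrite dS.
suff /negbTE-> : ~~ (arc_rel H u v && arc_rel H w v) by [].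
have [adj_uw|nuw] := boolP (dag_adjacent G u w); last by rewrite -same_colliders.
apply/negP => /andP[uvH wvH].
apply: (@minimal_no_shortcut G S j k a u v [::] w b qmin adj_uw) => [a' t aE|y b' bE].
- apply/idPn => tuw; have := @minimal_shielded_noncollider S j k a' t u v w b.
  by rewrite -aE (arc_asym wvH) => /(_ qmin nc adj_uw tuw).
apply/idPn; rewrite open_triple_sym => ywu.
have := @minimal_shielded_noncollider S k j (rev b') y w v u (rev a).
rewrite (arc_asym uvH) andbC dag_adjacent_sym => noncoll; apply: notF; apply: noncoll => //.
by have := minimal_trail_rev qmin; rewrite bE rev_cat !rev_cons -!cats1 -!catA.
Qed.

Lemma d_connected_transfer S j k : d_connected G j k S -> d_connected H j k S.
Proof.
move=> /d_connectedE[q /minimal_trail_exists[q' /minimal_trail_transfer qo]].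
by apply/d_connectedE; exists q'.
Qed.

End Transfer.

End Minimal.

(** * Separators and edge counts *)

Section Sep.
Context {p : nat}.
Implicit Types (G : dag p) (S : {set 'I_p}) (u v w x y z : 'I_p).

Theorem same_colliders_markov_equivalent G H :
  dag_adjacent G =2 dag_adjacent H ->
  (forall u v w, u != w -> ~~ dag_adjacent G u w ->
     arc_rel G u v && arc_rel G w v = arc_rel H u v && arc_rel H w v) ->
  markov_equivalent G H.
Proof.
move=> skel coll A B S _; split=> sep j k jA kB jk; apply: (sep j k jA kB).
  apply: d_connected_transfer jk => // u v w uw; rewrite -skel => nuw.
  by rewrite coll.
exact: d_connected_transfer jk.
Qed.

Lemma d_connected_adjacent G S j k : dag_adjacent G j k -> d_connected G j k S.
Proof.
move=> jk; exists [:: k]; split=> //=; first by rewrite jk.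
by rewrite inE (dag_adjacent_neq jk).
Qed.

Lemma d_connected_triple G S j l k :
  dag_adjacent G j l -> dag_adjacent G l k -> j != k ->
  open_triple G S j l k -> d_connected G j k S.
Proof.
move=> jl lk jk o; exists [:: l; k]; split=> //=; rewrite ?jl ?lk ?o //.
by rewrite !inE negb_or (dag_adjacent_neq jl) jk (dag_adjacent_neq lk).
Qed.

(** A trail that starts along an arrow out of [k] either follows arrows to its
    end or has a first collider, which is a descendant of [k]. *)
Lemma forward_trail_reaches G S k z q :
  path (dag_adjacent G) k (z :: q) -> open_path G S [:: k, z & q] ->
  arc_rel G k z ->
  reaches G S k || descendant_or_self G k (last z q).
Proof.
elim: q k z => [|w q IH] k z /= /andP[kz].
  by move=> _ _ kzG; apply/orP; right; apply: connect1.
move=> zq /andP[ouz oq] kzG; move: ouz; rewrite open_tripleE kzG /=.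
case: ifPn => [_ zS|wz _]; first by rewrite (reaches_arc kzG).
have zw : arc_rel G z w.
  by case/andP: zq => + _; rewrite dag_adjacent_sym => /adjacent_arc; apply; apply: negbTE.
case/orP: (IH z w zq oq zw) => [zS|zl]; first by rewrite (reaches_arc kzG).
by apply/orP; right; apply: connect_trans (connect1 kzG) zl.
Qed.

Definition parents G k := [set z | arc_rel G z k]%SET.

(** An open trail from [k] to [j] cannot begin with a parent of [k], which would
    be a non-collider in the conditioning set. So it starts along an arrow out
    of [k]; then [k] would be an ancestor of [j] or of its own parents. *)
Lemma parents_separate G j k : j != k -> ~~ dag_adjacent G j k ->
  ~~ descendant_or_self G k j -> ~ d_connected G j k (parents G k).
Proof.
move=> jk njk nkj /d_connected_sym[[|z q] [kq uq ql oq]].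
  by move: jk; rewrite -ql /= eqxx.
have kz : dag_adjacent G k z by case/andP: kq.
have [zk|zk] := boolP (arc_rel G z k).
  case: q ql kq uq oq => [|w q] /= ql kq uq oq.
    by rewrite -ql dag_adjacent_sym kz in njk.
  by move: oq; rewrite open_tripleE (arc_asym zk) /= inE zk.
have kzG : arc_rel G k z.
  by apply: (@adjacent_arc p G z k); rewrite 1?dag_adjacent_sym // (negbTE zk).
have /orP[/exists_inP[x]|] := forward_trail_reaches kq oq kzG.
  by rewrite inE => xk /(arc_connect_acyclic xk).
by rewrite -[last z q]/(last k (z :: q)) ql (negbTE nkj).
Qed.

Lemma nonadjacent_separated G j k : j != k -> ~~ dag_adjacent G j k ->
  exists S, [/\ j \notin S, k \notin S & ~ d_connected G j k S].
Proof.
move=> jk njk; have [kj|nkj] := boolP (descendant_or_self G k j); last first.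
  exists (parents G k); rewrite !inE arc_irrefl; split=> //.
    by apply: contra njk => jkG; rewrite arc_adjacent.
  exact: parents_separate.
have njk' : ~~ descendant_or_self G j k.
  apply/negP => /connectP[[|x s] /= jx kE]; first by move: jk; rewrite kE eqxx.
  case/andP: jx => jx xs; apply: (arc_connect_acyclic jx).
  by apply: connect_trans kj; apply/connectP; exists s.
exists (parents G j); rewrite !inE arc_irrefl; split=> //.
  by apply: contra njk => jkG; rewrite dag_adjacent_sym arc_adjacent.
move=> /d_connected_sym; apply: parents_separate => //; rewrite 1?eq_sym //.
by rewrite dag_adjacent_sym.
Qed.

(** A separating set [S] of an unshielded triple reveals its orientation. *)
Lemma separator_collider G S j l k :
  j != k -> dag_adjacent G j l -> dag_adjacent G l k -> ~ d_connected G j k S ->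
  arc_rel G j l && arc_rel G k l = (l \notin S).
Proof.
move=> jk jl lk sep; apply/idP/idP => [coll|lS].
  apply/negP => lS; apply/sep/(d_connected_triple jl lk jk).
  by rewrite open_tripleE coll reaches_mem.
apply/idPn => ncoll; apply/sep/(d_connected_triple jl lk jk).
by rewrite open_tripleE (negbTE ncoll).
Qed.

Lemma skeleton_num_edges G H :
  (forall x y, dag_adjacent G x y -> dag_adjacent H x y) ->
  (num_edges G <= num_edges H)%N /\
  (num_edges H <= num_edges G -> dag_adjacent G =2 dag_adjacent H)%N.
Proof.
move=> GH.
(* Send each arc of G to the arc of H on the same edge. *)
pose f (e : 'I_p * 'I_p) := if e \in arcs H then e else (e.2, e.1).
have f_inj : {in arcs G &, injective f}.
  move=> [x y] [x' y'] xy x'y'; rewrite /f.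
  case: ifP => _; case: ifP => _ //= [] E1 E2; subst => //.
  - by move: xy => /(@arc_asym p G); rewrite /arc_rel x'y'.
  - by move: xy => /(@arc_asym p G); rewrite /arc_rel x'y'.
have fH : f @: arcs G \subset arcs H.
  apply/fintype.subsetP => _ /imsetP[[x y] xy ->]; rewrite /f; case: ifP => //= nxy.
  exact: adjacent_arc (GH _ _ (arc_adjacent xy)) nxy.
have cf : #|f @: arcs G| = num_edges G by rewrite card_in_imset.
split=> [|HG]; first by rewrite -cf subset_leq_card.
have fE : f @: arcs G = arcs H by apply/eqP; rewrite eqEcard fH cf.
have HG' x y : arc_rel H x y -> dag_adjacent G x y.
  rewrite /arc_rel -fE => /imsetP[[x' y'] xy]; rewrite /f.
  case: ifP => _ [-> ->]; first exact: arc_adjacent.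
  by rewrite dag_adjacent_sym arc_adjacent.
move=> x y; apply/idP/idP; first exact: GH.
by case/orP => /HG' //; rewrite dag_adjacent_sym.
Qed.

End Sep.

(** * Sparsity of faithful graphs *)

Section Faithful.
Context (R : realType) (d : measure_display) (T : measurableType d)
  (P : probability T R) (p : nat) (d' : 'I_p -> measure_display)
  (V : forall i, measurableType (d' i)) (X : forall i, {RV P >-> V i}).

Lemma markov_nonadjacent (G : dag p) j k : markov_property X G ->
  j != k -> ~~ dag_adjacent G j k ->
  exists S : {set 'I_p}, [/\ j \notin S, k \notin S, ~ d_connected G j k S
               & cond_indep X [set j]%SET [set k]%SET S].
Proof.
move=> mG jk njk; have [S [jS kS sep]] := nonadjacent_separated jk njk.
exists S; split=> //; apply: mG; last by move=> _ _ /set1P-> /set1P->.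
by rewrite /pairwise_disjoint3 !disjoints1 jS kS inE jk.
Qed.

Lemma adjacency_faithful_skeleton (Gs G : dag p) :
  adjacency_faithful X Gs -> markov_property X G ->
  forall x y, dag_adjacent Gs x y -> dag_adjacent G x y.
Proof.
move=> af mG.
have arcP x y : arc_rel Gs x y -> dag_adjacent G x y.
  move=> xy; apply/idPn => nxy.
  have [S [xS yS _]] := markov_nonadjacent mG (dag_adjacent_neq (arc_adjacent xy)) nxy.
  exact: af xy xS yS.
by move=> x y /orP[/arcP//|/arcP]; rewrite dag_adjacent_sym.
Qed.

(** Adjacency-faithfulness settles the skeletons, so only the orientation of the
    unshielded triples of competing DAGs is left to compare. This part is
    common to the implication and to the counterexample. *)
Lemma adjacency_faithful_smr (Gs : dag p) :
  markov_property X Gs -> adjacency_faithful X Gs ->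
  (forall G : dag p, markov_property X G -> dag_adjacent Gs =2 dag_adjacent G ->
     forall u v w, u != w -> dag_adjacent G u v -> dag_adjacent G v w ->
     ~~ dag_adjacent G u w ->
     arc_rel Gs u v && arc_rel Gs w v = arc_rel G u v && arc_rel G w v) ->
  smr X Gs.
Proof.
move=> mGs af coll; split=> // G mG neq; rewrite ltnNge; apply/negP => le.
have [_ /(_ le) skel] := skeleton_num_edges (adjacency_faithful_skeleton af mG).
apply/neq/same_colliders_markov_equivalent => // u v w uw nuw.
have [uv|nuv] := boolP (dag_adjacent G u v); last first.
  move: nuv (nuv); rewrite {1}/dag_adjacent -skel negb_or => /andP[/negbTE-> _].
  by rewrite negb_or => /andP[/negbTE-> _].
have [vw|nvw] := boolP (dag_adjacent G v w); last first.
  move: nvw (nvw); rewrite {1}/dag_adjacent -skel !negb_or => /andP[_ /negbTE->].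
  by move=> /andP[_ /negbTE->]; rewrite !andbF.
by apply: coll => //; rewrite -skel.
Qed.

Lemma restricted_faithful_smr (Gs : dag p) : restricted_faithful X Gs -> smr X Gs.
Proof.
move=> [mGs af orf]; apply: adjacency_faithful_smr => // G mG skel u v w uw uv vw nuw.
have [S [uS wS sep ci]] := markov_nonadjacent mG uw nuw.
rewrite [RHS](separator_collider uw uv vw sep).
rewrite -!skel in uv vw nuw.
apply: separator_collider => // conn; exact: orf uw uv vw nuw uS wS conn ci.
Qed.

End Faithful.

(** * Conditional independence on atoms *)

Section CondIndep.
Local Open Scope classical_set_scope.
Local Open Scope ring_scope.
Context (R : realType) (d : measure_display) (T : measurableType d)
  (P : probability T R) (p : nat) (d' : 'I_p -> measure_display)
  (V : forall i, measurableType (d' i)) (X : forall i, {RV P >-> V i}).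
Implicit Types (A B S : {set 'I_p}).

Lemma sigma_rv_sub_measurable S : sigma_rv X S `<=` measurable.
Proof.
apply: smallest_sub; first exact: sigma_algebra_measurable.
by move=> E [i _ [B mB <-]]; apply: measurable_funPT.
Qed.

Definition agree_on S w w' := forall i, i \in S -> X i w = X i w'.

(** The sets that do not separate [w] from [w'] form a sigma-algebra. *)
Lemma sigma_rv_saturated S E w w' : sigma_rv X S E -> agree_on S w w' -> E w -> E w'.
Proof.
move=> SE ww'; suff : E w <-> E w' by case.
pose F := [set E : set T | E w <-> E w'].
apply: (smallest_sub (X := F) _ _ SE) => [|_ [i iS [B _ <-]]]; last first.
  by split=> -[_ BX]; split=> //; move: BX; rewrite /preimage /= ww'.
split=> [|C FC|C FC]; first by split.
- by split=> -[_ nC]; split=> // /FC.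
by split=> -[n _ /FC Cn]; exists n.
Qed.

(** A version of a conditional probability is constant on an atom of the
    conditioning sigma-algebra, so it equals the elementary ratio there. *)
Lemma cond_prob_atom S E f D w :
  is_cond_prob P (sigma_rv X S) E f -> sigma_rv X S D ->
  (forall w', D w' -> agree_on S w w') ->
  P (E `&` D) = ((f w)%:E * P D)%E.
Proof.
move=> [fS _ fD] SD Dw; rewrite -fD // -integral_cst; last exact: sigma_rv_sub_measurable SD.
apply: eq_integral => w' /set_mem Dw'; congr (_%:E).
have : sigma_rv X S (f @^-1` [set f w]).
  by apply: fS; exists [set f w] => //; rewrite setTI.
by move/sigma_rv_saturated => /(_ _ _ (Dw _ Dw') erefl).
Qed.

(** The almost sure product formula holds at some point of a non-null atom, and
    there all the versions involved are constant. *)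
Lemma cond_indep_atom A B S E1 E2 D w : cond_indep X A B S ->
  sigma_rv X A E1 -> sigma_rv X B E2 -> sigma_rv X S D ->
  (forall w', D w' -> agree_on S w w') -> P D != 0%E ->
  (P (E1 `&` E2 `&` D) * P D = P (E1 `&` D) * P (E2 `&` D))%E.
Proof.
move=> ci AE1 BE2 SD Dw PD; have [f1 [f2 [f12 [f1E f2E f12E ae]]]] := ci _ _ AE1 BE2.
have [w0 [Dw0 f12w0]] : exists w0, D w0 /\ f12 w0 = f1 w0 * f2 w0.
  apply: contrapT => noD; move/negP: PD; apply; apply/eqP.
  apply: (negligibleP _ _).1; first exact: sigma_rv_sub_measurable SD.
  apply: negligibleS ae => w' Dw' /= f12w'; apply: noD; by exists w'.
have D0 w' : D w' -> agree_on S w0 w'.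
  by move=> Dw' i iS; rewrite -(Dw _ Dw0 i iS) (Dw _ Dw' i iS).
rewrite (cond_prob_atom f12E SD D0) (cond_prob_atom f1E SD D0) (cond_prob_atom f2E SD D0).
by rewrite f12w0 EFinM -!muleA; congr (_ * _)%E; rewrite muleCA.
Qed.

Lemma cond_indep_sym A B S : cond_indep X A B S -> cond_indep X B A S.
Proof.
move=> ci E1 E2 BE1 AE2; have [f2 [f1 [f12 [f2E f1E f12E ae]]]] := ci _ _ AE2 BE1.
exists f1, f2, f12; split=> //; first by rewrite setIC.
by move: ae; apply: filterS => w ->; rewrite mulrC.
Qed.

End CondIndep.

(** * Uniform distributions on an initial segment of the naturals *)

Section Uniform.
Local Open Scope classical_set_scope.
Local Open Scope ring_scope.
Context (R : realType) (n : nat).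

(** The parameter is the largest point, so that the support is never empty. *)
Definition uniform_nat : set nat -> \bar R :=
  mscale (n.+1%:R^-1)%:nng (msum (fun k => \d_k) n.+1).

HB.instance Definition _ := Measure.on uniform_nat.

Definition npoints (E : set nat) : nat := \sum_(i < n.+1) ((i : nat) \in E).

Lemma uniform_natE E : uniform_nat E = ((npoints E)%:R / n.+1%:R)%:E.
Proof.
rewrite /uniform_nat /mscale /msum /= mulrC EFinM; congr (_ * _)%E.
rewrite natr_sum -sumEFin; apply: eq_bigr => i _.
by rewrite [LHS]diracE.
Qed.

Let uniform_nat_setT : uniform_nat setT = 1%E.
Proof.
rewrite uniform_natE /npoints (eq_bigr (fun=> 1%N)) => [|i _]; last by rewrite in_setT.
by rewrite sum_nat_const muln1 card_ord divff ?pnatr_eq0.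
Qed.

HB.instance Definition _ :=
  Measure_isProbability.Build _ _ _ uniform_nat uniform_nat_setT.

Definition unif : probability nat R := uniform_nat.

Lemma unifE E : unif E = ((npoints E)%:R / n.+1%:R)%:E.
Proof. exact: uniform_natE. Qed.

Lemma integral_uniform_nat (D : set nat) (f : nat -> R) : (forall i, 0 <= f i) ->
  (\int[unif]_(i in D) (f i)%:E)%E =
  ((\sum_(i < n.+1) ((i : nat) \in D)%:R * f i) / n.+1%:R)%:E.
Proof.
move=> f0; rewrite /unif [LHS]ge0_integral_mscale //=; last by move=> i _; rewrite lee_fin.
rewrite ge0_integral_measure_sum //; last by move=> i _; rewrite lee_fin.
rewrite mulrC EFinM -sumEFin; congr (_ * _)%E.
by apply: eq_bigr => i _; rewrite integral_dirac // diracE.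
Qed.

End Uniform.

Section UniformCI.
Local Open Scope classical_set_scope.
Local Open Scope ring_scope.
Context (R : realType) (n p : nat) (X : forall i : 'I_p, {RV (unif R n) >-> R}).
Implicit Types (A B S : {set 'I_p}).

(** The level set of the subvector indexed by [S] through [w]. *)
Definition atom S w : set nat := [set w' | agree_on X S w w'].

Lemma atom_sigma_rv S w : sigma_rv X S (atom S w).
Proof.
pose G := \bigcup_(i in [set` S]) g_sigma_algebra_preimage (X i).
have -> : atom S w = \bigcap_(i in [set` S]) (X i @^-1` [set X i w]).
  by apply/seteqP; split=> w' ww' i iS; [exact/esym/ww'|exact/esym/(ww' i iS)].
apply: (@fin_bigcap_measurable _ (g_sigma_algebraType G)) => [|i iS].
  exact: finite_finset.
apply: sub_sigma_algebra; exists i => //; exists [set X i w]; rewrite ?setTI //.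
Qed.

Lemma atom_sym S w w' : atom S w w' -> atom S w' w.
Proof. by move=> h i iS; rewrite h. Qed.

Lemma atom_eq S w w' : atom S w w' -> atom S w' = atom S w.
Proof.
move=> ww'; apply/seteqP; split=> v wv i iS; first by rewrite ww' // wv.
by rewrite -ww' // wv.
Qed.

Let cnt := npoints n.

Definition atom_prob S (E : set nat) (w : nat) : R :=
  (cnt (E `&` atom S w))%:R / (cnt (atom S w))%:R.

Lemma npoints_gt0 (E : set nat) (w : 'I_n.+1) : E w -> (0 < cnt E)%N.
Proof.
move=> Ew; rewrite lt0n /cnt /npoints sum_nat_eq0; apply/forallPn.
by exists w; rewrite (mem_set Ew).
Qed.

(** Averaging the elementary conditional probability over a saturated set [D]
    counts every point [m] of the intersection of [E] and [D] once, with the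
    weights [1 / npoints (atom m)] of the points of the atom of [m]. *)
Lemma is_cond_prob_atom_prob S E : is_cond_prob (unif R n) (sigma_rv X S) E (atom_prob S E).
Proof.
have f0 w : 0 <= atom_prob S E w by rewrite divr_ge0.
have sat (D : set nat) : (forall w w', atom S w w' -> D w -> D w') -> sigma_rv X S D.
  move=> Dsat; have -> : D = \bigcup_(w in D) atom S w.
    apply/seteqP; split=> [w Dw|w' [w Dw ww']]; first by exists w.
    exact: Dsat ww' Dw.
  pose G := \bigcup_(i in [set` S]) g_sigma_algebra_preimage (X i).
  apply: (@bigcup_measurable _ (g_sigma_algebraType G)) => w _.
  exact: atom_sigma_rv.
split.
- move=> _ [B mB <-]; rewrite setTI; apply: sat => w w' ww'.
  by rewrite /preimage /= /atom_prob (atom_eq ww').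
- apply/integrableP; split=> //.
  under eq_integral do rewrite gee0_abs ?lee_fin //.
  by rewrite integral_uniform_nat // ltry.
move=> D SD; rewrite integral_uniform_nat // unifE; congr ((_ / _)%:E).
have Dsat w w' : atom S w w' -> (w \in D) = (w' \in D).
  move=> ww'; apply/idP/idP => /set_mem Dw; apply/mem_set;
    apply: (sigma_rv_saturated SD) Dw => //.
  exact: atom_sym.
have atomC w w' : (w \in atom S w') = (w' \in atom S w).
  by apply/idP/idP => /set_mem /atom_sym /mem_set.
rewrite natr_sum.
transitivity (\sum_(i < n.+1) \sum_(m < n.+1)
    ((m : nat) \in E `&` D)%:R * (((i : nat) \in atom S m)%:R / (cnt (atom S m))%:R) : R).
  apply: eq_bigr => i _; rewrite /atom_prob {1}/cnt /npoints natr_sum mulr_suml mulr_sumr.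
  apply: eq_bigr => m _; rewrite !in_setI (atomC i m).
  have [im|] := boolP ((m : nat) \in atom S i); last by rewrite andbF !mul0r !mulr0.
  rewrite (atom_eq (set_mem im)) (Dsat _ _ (set_mem im)) andbT mul1r mulrA -natrM.
  by rewrite mulnb andbC.
rewrite exchange_big; apply: eq_bigr => m _ /=.
rewrite -mulr_sumr -mulr_suml -natr_sum divff ?mulr1 //.
by rewrite pnatr_eq0 -lt0n; apply: (npoints_gt0 (w := m)).
Qed.

Lemma cond_indep_of_counts A B S :
  (forall (E1 E2 : set nat) (w : 'I_n.+1), sigma_rv X A E1 -> sigma_rv X B E2 ->
    (cnt (E1 `&` E2 `&` atom S w) * cnt (atom S w) =
     cnt (E1 `&` atom S w) * cnt (E2 `&` atom S w))%N) ->
  cond_indep X A B S.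
Proof.
move=> h E1 E2 AE1 BE2.
exists (atom_prob S E1), (atom_prob S E2), (atom_prob S (E1 `&` E2)).
split; [exact: is_cond_prob_atom_prob..|].
(* The product rule is known for the atoms of points up to n; the other
   points form a null set. *)
exists [set w | (n < w)%N]; split=> //.
  rewrite unifE /npoints big1 ?mul0r // => i _.
  by apply/eqP; rewrite eqb0; apply/negP => /set_mem /=; rewrite ltnNge -ltnS ltn_ord.
move=> w /=; apply: contra_notP => /negP; rewrite -leqNgt -ltnS => wn.
have := h _ _ (Ordinal wn) AE1 BE2; rewrite /= => hw.
have c0 : (cnt (atom S w))%:R != 0 :> R.
  by rewrite pnatr_eq0 -lt0n; apply: (npoints_gt0 (w := Ordinal wn)).
rewrite /atom_prob mulf_div -natrM -hw natrM -mulf_div divff // mulr1 //.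
Qed.

Lemma cond_indep_counts A B S E1 E2 (w : 'I_n.+1) : cond_indep X A B S ->
  sigma_rv X A E1 -> sigma_rv X B E2 ->
  (cnt (E1 `&` E2 `&` atom S w) * cnt (atom S w) =
   cnt (E1 `&` atom S w) * cnt (E2 `&` atom S w))%N.
Proof.
move=> ci AE1 BE2.
have := @cond_indep_atom _ _ _ _ _ _ _ X A B S E1 E2 (atom S w) w ci AE1 BE2
  (@atom_sigma_rv S w) (fun _ => id).
rewrite !unifE -!EFinM.
have n0 : n.+1%:R != 0 :> R by rewrite pnatr_eq0.
have -> : ((npoints n (atom S w))%:R / n.+1%:R)%:E != 0%E :> \bar R.
  rewrite eqe mulf_neq0 ?invr_neq0 // pnatr_eq0 -lt0n.
  by apply: (npoints_gt0 (w := w)).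
move=> /(_ isT) [] /(congr1 (fun z => z * (n.+1%:R * n.+1%:R))).
rewrite !mulf_div !divfK ?mulf_neq0 // -!natrM => /eqP.
by rewrite eqr_nat => /eqP.
Qed.

End UniformCI.

(** * A diamond with an accidental marginal independence *)

Notation v0 := (@Ordinal 4 0 isT).
Notation v1 := (@Ordinal 4 1 isT).
Notation v2 := (@Ordinal 4 2 isT).
Notation v3 := (@Ordinal 4 3 isT).

Variant ord4_spec : 'I_4 -> Type :=
  Ord4_0 : ord4_spec v0 | Ord4_1 : ord4_spec v1
| Ord4_2 : ord4_spec v2 | Ord4_3 : ord4_spec v3.

Lemma ord4P (i : 'I_4) : ord4_spec i.
Proof.
by case: i => [[|[|[|[|//]]]] lt_i4];
  rewrite (bool_irrelevance lt_i4 isT); constructor.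
Qed.

Section Diamond.

Definition diamond_arcs : {set 'I_4 * 'I_4} :=
  [set e : 'I_4 * 'I_4 |
     ((e.1 : nat), (e.2 : nat)) \in [:: (0, 1); (0, 2); (1, 3); (2, 3)]%N]%SET.

Lemma diamond_acyclic (c : seq 'I_4) :
  c != [::] -> ~~ cycle (fun x y : 'I_4 => (x, y) \in diamond_arcs) c.
Proof.
case: c => // x s _; apply/negP => /= xs.
have {xs} : path (fun x y : 'I_4 => (x < y)%N) x (rcons s x).
  by apply: sub_path xs => i j; case: (ord4P i); case: (ord4P j); rewrite inE.
move/(order_path_min (fun _ _ _ => @ltn_trans _ _ _))/allP/(_ x).
by rewrite mem_rcons mem_head ltnn => /(_ isT).
Qed.

Definition diamond := Dag diamond_acyclic.

Lemma diamond_arcE (x y : 'I_4) : arc_rel diamond x y =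
  (((x : nat), (y : nat)) \in [:: (0, 1); (0, 2); (1, 3); (2, 3)]%N).
Proof. by rewrite /arc_rel inE. Qed.

(** Up to symmetry, only two separations with nonempty sides hold in the
    diamond, each involving two single opposite vertices. *)
Lemma diamond_separations (A B S : {set 'I_4}) (j k : 'I_4) :
  pairwise_disjoint3 A B S -> d_separated diamond A B S ->
  j \in A -> k \in B -> (j < k)%N ->
  [/\ A = [set v0], B = [set v3] & S = [set v1; v2]]%SET \/
  [/\ A = [set v1], B = [set v2] & S = [set v0]]%SET.
Proof.
move=> /and3P[dAB dAS dBS] sep jA kB jk.
have nadj x y : x \in A -> y \in B -> dag_adjacent diamond x y = false.
  by move=> xA yB; apply/negP => /(@d_connected_adjacent _ _ S); exact: sep xA yB.
have coll l : dag_adjacent diamond j l -> dag_adjacent diamond l k ->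
    (l \in S) = ~~ (arc_rel diamond j l && arc_rel diamond k l).
  move=> jl lk; rewrite (separator_collider (S := S) _ jl lk) ?negbK //.
    by apply: contraTneq jk => ->; rewrite ltnn.
  exact: sep jA kB.
have jB : j \in B = false := disjointFr dAB jA.
have jS : j \in S = false := disjointFr dAS jA.
have kA : k \in A = false := disjointFl dAB kB.
have kS : k \in S = false := disjointFr dBS kB.
have inS x : x \in S -> (x \in A) = false /\ (x \in B) = false.
  by move=> xS; rewrite (disjointFl dAS) // (disjointFl dBS).
move: jk jA kB jB jS kA kS coll (nadj _ _ jA kB).
case: (ord4P j); case: (ord4P k) => // _ jA kB jB jS kA kS coll;
  rewrite /dag_adjacent !diamond_arcE // => _.
- have S1 : v1 \in S by rewrite coll /dag_adjacent !diamond_arcE.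
  have S2 : v2 \in S by rewrite coll /dag_adjacent !diamond_arcE.
  have [[A1 B1] [A2 B2]] := (inS _ S1, inS _ S2).
  left; split; apply/setP => x; case: (ord4P x); rewrite !inE;
    by rewrite ?jA ?jB ?jS ?kA ?kB ?kS ?S1 ?S2 ?A1 ?B1 ?A2 ?B2.
have S0 : v0 \in S by rewrite coll /dag_adjacent !diamond_arcE.
have S3 : (v3 \in S) = false by rewrite coll /dag_adjacent !diamond_arcE.
have A3 : (v3 \in A) = false.
  by apply/negP => /nadj/(_ kB); rewrite /dag_adjacent !diamond_arcE.
have B3 : (v3 \in B) = false.
  by apply/negP => /(nadj _ _ jA); rewrite /dag_adjacent !diamond_arcE.
have [A0 B0] := inS _ S0.
right; split; apply/setP => x; case: (ord4P x); rewrite !inE;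
  by rewrite ?jA ?jB ?jS ?kA ?kB ?kS ?S0 ?S3 ?A0 ?B0 ?A3 ?B3.
Qed.

End Diamond.

Section Witness.
Local Open Scope ring_scope.
Context {R : realType}.

(** Column [m] lists the values of the four variables at [m = u + 3 c + 6 d],
    where [u] is in [{0, 1, 2}] and [c], [d] are bits: they are [u],
    [(u == 0) + 2 c], [(u == 1) + 2 d] and [c && d]. A table of values keeps
    the exhaustive checks below cheap. *)
Definition value (i m : nat) : nat :=
  nth 0%N (nth [::] [:: [:: 0; 1; 2; 0; 1; 2; 0; 1; 2; 0; 1; 2];
                        [:: 1; 0; 0; 3; 2; 2; 1; 0; 0; 3; 2; 2];
                        [:: 0; 1; 0; 0; 1; 0; 2; 3; 2; 2; 3; 2];
                        [:: 0; 0; 0; 0; 0; 0; 0; 0; 0; 1; 1; 1]] i)%N m.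

Lemma value_lt4 i m : (value i m < 4)%N.
Proof.
have row_lt4 (r : seq nat) : all (fun v => (v < 4)%N) r -> (nth 0%N r m < 4)%N.
  move=> r4; have [mr|rm] := ltnP m (size r); last by rewrite nth_default.
  exact: all_nthP r4 m mr.
by apply: row_lt4; case: i => [|[|[|[|i]]]] //=; rewrite nth_nil.
Qed.

Definition outcomes : seq nat := iota 0 12.

Definition diamond_rv (i : 'I_4) : {RV (unif R 11) >-> R} :=
  let f (m : nat) : R := (value i m)%:R in
  HB.pack f (isMeasurableFun.Build _ _ _ _ f (fun _ _ _ => I)).

(** A finite set in a form that computes once the four memberships are known. *)
Definition indices (S : {set 'I_4}) : seq nat :=
  mask [:: v0 \in S; v1 \in S; v2 \in S; v3 \in S] (iota 0 4).

Definition agreeb (s : seq nat) (w m : nat) :=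
  all (fun i => value i w == value i m) s.

Lemma agreebE (S : {set 'I_4}) w m : agreeb (indices S) w m =
  [&& (v0 \in S) ==> (value 0 w == value 0 m), (v1 \in S) ==> (value 1 w == value 1 m),
      (v2 \in S) ==> (value 2 w == value 2 m) & (v3 \in S) ==> (value 3 w == value 3 m)].
Proof.
rewrite /agreeb /indices.
by case: (v0 \in S); case: (v1 \in S); case: (v2 \in S); case: (v3 \in S); rewrite /= ?andbT.
Qed.

Lemma diamond_rv_eq (i : 'I_4) w m : diamond_rv i w = diamond_rv i m <-> value i w = value i m.
Proof.
split=> [/eqP|E]; first by rewrite eqr_nat => /eqP.
by rewrite [LHS](_ : _ = (value i w)%:R) // E.
Qed.

Lemma agree_onE (S : {set 'I_4}) w m : agree_on diamond_rv S w m <-> agreeb (indices S) w m.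
Proof.
rewrite agreebE; split=> [h|/and4P[h0 h1 h2 h3] i iS].
  by apply/and4P; split; apply/implyP => iS; apply/eqP;
    exact: (diamond_rv_eq _ w m).1 (h _ iS).
apply/diamond_rv_eq; case: (ord4P i) iS => iS; apply/eqP.
- exact: (implyP h0).
- exact: (implyP h1).
- exact: (implyP h2).
- exact: (implyP h3).
Qed.

Lemma npoints_count (E : set nat) (q : pred nat) : (forall m, E m <-> q m) ->
  npoints 11 E = count q outcomes.
Proof.
move=> Eq; rewrite -sum1_count -[outcomes]/(index_iota 0 12) big_mkcond big_mkord /=.
apply: eq_bigr => i _; suff -> : ((i : nat) \in E) = q i by case: (q i).
by apply/idP/idP => [/set_mem/Eq|/Eq/mem_set].
Qed.

Definition product_rule (e1 e2 e : pred nat) :=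
  let cnt q := count q outcomes in
  (cnt (fun m => [&& e1 m, e2 m & e m]) * cnt e ==
   cnt (fun m => e1 m && e m) * cnt (fun m => e2 m && e m))%N.

Lemma product_ruleP (E1 E2 D : set nat) (e1 e2 e : pred nat) :
  (forall m, E1 m <-> e1 m) -> (forall m, E2 m <-> e2 m) -> (forall m, D m <-> e m) ->
  (npoints 11 (E1 `&` E2 `&` D) * npoints 11 D =
   npoints 11 (E1 `&` D) * npoints 11 (E2 `&` D))%N <-> product_rule e1 e2 e.
Proof.
move=> h1 h2 h.
have h1' m : (E1 `&` D)%classic m <-> e1 m && e m.
  by split=> [[/h1-> /h->]|/andP[/h1 ? /h ?]].
have h2' m : (E2 `&` D)%classic m <-> e2 m && e m.
  by split=> [[/h2-> /h->]|/andP[/h2 ? /h ?]].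
have h12 m : (E1 `&` E2 `&` D)%classic m <-> [&& e1 m, e2 m & e m].
  by split=> [[[/h1-> /h2->] /h->]|/and3P[/h1 ? /h2 ? /h ?]].
rewrite (npoints_count h) (npoints_count h1') (npoints_count h2') (npoints_count h12).
by split=> /eqP.
Qed.

Definition dependentb (s : seq nat) (j k : nat) :=
  let pts := outcomes in
  has (fun u => has (fun v => has (fun w =>
    ~~ product_rule (agreeb [:: j] u) (agreeb [:: k] v) (agreeb s w)) pts) pts) pts.

Lemma atom1 (j : 'I_4) u m : atom diamond_rv [set j] u m <-> agreeb [:: (j : nat)] u m.
Proof.
rewrite /agreeb /= andbT; split=> [h|/eqP h i /set1P->].
  by apply/eqP/diamond_rv_eq/h; rewrite inE.
exact/diamond_rv_eq.
Qed.

Lemma dependent_not_cond_indep (j k : 'I_4) (S : {set 'I_4}) :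
  dependentb (indices S) j k -> ~ cond_indep diamond_rv [set j] [set k] S.
Proof.
move=> /hasP[u _ /hasP[v _ /hasP[w]]]; rewrite mem_iota => /= w12 /negP nrule ci.
apply: nrule; apply/(product_ruleP (atom1 j u) (atom1 k v) (agree_onE S w)).
by apply: (@cond_indep_counts _ _ _ _ _ _ _ _ _ (Ordinal w12) ci); exact: atom_sigma_rv.
Qed.

(** Cardinalities are additive over the values of a variable, which reduces the
    product rule for arbitrary events to single values. *)
Lemma count_by_value (x : nat -> nat) (f q : pred nat) (s : seq nat) :
  (forall m, x m < 4)%N ->
  count (fun m => f (x m) && q m) s =
  (\sum_(a < 4) f a * count (fun m => (x m == a) && q m) s)%N.
Proof.
move=> x4; elim: s => [|m s IH] /=; first by rewrite big1 // => a _; rewrite muln0.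
under eq_bigr do rewrite mulnDr.
rewrite big_split /= -IH; congr (_ + _)%N.
rewrite (bigD1 (Ordinal (x4 m))) //= eqxx mulnb big1 ?addn0 // => a.
by rewrite -val_eqE eq_sym => /negbTE /= ->; rewrite muln0.
Qed.

Lemma sigma_rv1 (j : 'I_4) (E : set nat) : sigma_rv diamond_rv [set j] E ->
  exists f : pred nat, forall m, E m <-> f (value j m).
Proof.
move=> jE; exists (fun v => `[< exists2 m, value j m = v & E m >]) => m.
split=> [Em|/asboolP[m' m'm Em']]; first by apply/asboolP; exists m.
by apply: (sigma_rv_saturated jE) Em' => i /set1P->; apply/diamond_rv_eq.
Qed.

Definition independentb (s : seq nat) (j k : nat) :=
  all (fun a => all (fun b => all (fun w =>
    product_rule (fun m => value j m == a) (fun m => value k m == b) (agreeb s w))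
  outcomes) (iota 0 4)) (iota 0 4).

Lemma independent_cond_indep (j k : 'I_4) (S : {set 'I_4}) :
  independentb (indices S) j k -> cond_indep diamond_rv [set j] [set k] S.
Proof.
move=> /allP ind; apply: cond_indep_of_counts => E1 E2 w jE1 kE2.
have [f fE] := sigma_rv1 jE1; have [g gE] := sigma_rv1 kE2.
apply/(product_ruleP fE gE (agree_onE S w)).
have wpt : (w : nat) \in outcomes by rewrite mem_iota ltn_ord.
have rule (a b : 'I_4) :
    product_rule (fun m => value j m == a) (fun m => value k m == b) (agreeb (indices S) w).
  have := ind a; rewrite mem_iota ltn_ord => /(_ isT)/allP/(_ (b : nat)).
  by rewrite mem_iota ltn_ord => /(_ isT)/allP; apply.
move: (agreeb (indices S) w) rule => e; rewrite /product_rule => rule.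
apply/eqP; move: outcomes rule => pts rule.
have fvar q := count_by_value f q pts (value_lt4 j).
have gvar q := count_by_value g q pts (value_lt4 k).
rewrite (fvar (fun m => g (value k m) && e m)) fvar gvar big_distrl big_distrlr /=.
apply: eq_bigr => a _.
rewrite (eq_count (a2 := fun m => g (value k m) && ((value j m == a) && e m))); last first.
  by move=> m /=; rewrite andbCA.
rewrite gvar big_distrr big_distrl /=; apply: eq_bigr => b _.
rewrite mulnACA -(eqP (rule a b)) !mulnA; congr (_ * _ * _)%N.
by apply: eq_count => m /=; rewrite andbCA.
Qed.

Lemma cond_indep0 (B S : {set 'I_4}) : cond_indep diamond_rv finset.set0 B S.
Proof.
apply: cond_indep_of_counts => E1 E2 w E1s _.
have E1w m m' : E1 m -> E1 m' by apply: (sigma_rv_saturated E1s) => i; rewrite inE.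
have [[m E1m]|nE1] := pselect (exists m, E1 m).
  have -> : E1 = setT by apply/seteqP; split=> // m' _; apply: E1w E1m.
  by rewrite !setTI mulnC.
have -> : E1 = set0 by apply/seteqP; split=> // m' E1m'; case: nE1; exists m'.
by rewrite !set0I /npoints big1 ?mul0n // => i _; rewrite in_set0.
Qed.

Lemma diamond_markov : markov_property diamond_rv diamond.
Proof.
move=> A B S disj sep.
have [->|[j jA]] := set_0Vmem A; first exact: cond_indep0.
have [->|[k kB]] := set_0Vmem B; first exact/cond_indep_sym/cond_indep0.
wlog jk : A B j k disj sep jA kB / (j < k)%N => [ordered|].
  have [dAB dAS dBS] := and3P disj.
  case: (ltngtP j k) => [jk|kj|/val_inj jk].
  - exact: ordered disj sep jA kB jk.
  - apply/cond_indep_sym/(ordered B A k j) => //.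
      by rewrite /pairwise_disjoint3 disjoint_sym dAB dBS dAS.
    by move=> x y xB yA /d_connected_sym; exact: (sep _ _ yA xB).
  - by rewrite -jk (disjointFr dAB jA) in kB.
have [[-> -> ->]|[-> -> ->]] := diamond_separations disj sep jA kB jk;
  by apply: independent_cond_indep; rewrite /indices !inE; vm_compute.
Qed.

Lemma diamond_adjacency_faithful : adjacency_faithful diamond_rv diamond.
Proof.
move=> j k S; rewrite diamond_arcE.
case: (ord4P j); case: (ord4P k) => // _ /negbTE jS /negbTE kS;
  apply: dependent_not_cond_indep; rewrite /indices jS kS.
- by case: (v2 \in S); case: (v3 \in S); vm_compute.
- by case: (v1 \in S); case: (v3 \in S); vm_compute.
- by case: (v0 \in S); case: (v2 \in S); vm_compute.
- by case: (v0 \in S); case: (v1 \in S); vm_compute.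
Qed.

(** Given no variable, [X3] alone, or both [X0] and [X3], the two middle
    variables are dependent: through [u] in the first two cases, and through
    the conditioning on [c && d] in the last. *)
Lemma middle_separator (S : {set 'I_4}) : cond_indep diamond_rv [set v1] [set v2] S ->
  v1 \notin S -> v2 \notin S -> (v0 \in S) && (v3 \notin S).
Proof.
move=> ci /negbTE S1 /negbTE S2; apply/idPn => nS.
apply: dependent_not_cond_indep ci; rewrite /indices S1 S2; move: nS.
by case: (v0 \in S); case: (v3 \in S) => // _; vm_compute.
Qed.

(** A competing DAG has the diamond as skeleton. A set separating [1] from [2]
    contains [0] and not [3], so [3] is a collider and [0] is not; the
    arrows into [3] make [1] and [2] non-colliders. *)
Lemma diamond_smr : smr diamond_rv diamond.
Proof.
apply: adjacency_faithful_smr diamond_markov diamond_adjacency_faithful _.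
move=> G mG skel.
have [//|//|S [S1 S2 sep ci]] := @markov_nonadjacent _ _ _ _ _ _ _ diamond_rv G v1 v2 mG.
  by rewrite -skel /dag_adjacent !diamond_arcE.
have /andP[S0 S3] := middle_separator ci S1 S2.
have coll0 : arc_rel G v1 v0 && arc_rel G v2 v0 = false.
  by rewrite (separator_collider _ _ _ sep) ?S0 // -skel /dag_adjacent !diamond_arcE.
have /andP[a13 a23] : arc_rel G v1 v3 && arc_rel G v2 v3.
  by rewrite (separator_collider _ _ _ sep) // -skel /dag_adjacent !diamond_arcE.
move=> u v w; rewrite -!skel /dag_adjacent !diamond_arcE.
case: (ord4P u); case: (ord4P v) => //; case: (ord4P w) => //= _ _ _ _;
  by rewrite ?(arc_asym a13) ?(arc_asym a23) ?a13 ?a23 ?andbF // 1?andbC coll0.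
Qed.

(** The trail [0 -> 1 -> 3] is open given nothing, while [u] is independent of
    [c && d]. *)
Lemma diamond_not_faithful : ~ restricted_faithful diamond_rv diamond.
Proof.
move=> [_ _ /(_ v0 v3 v1 finset.set0) nci].
apply: nci; rewrite ?inE ?/dag_adjacent ?diamond_arcE //.
- apply: (@d_connected_triple _ _ _ _ v1); rewrite // /dag_adjacent ?diamond_arcE //.
  by rewrite open_tripleE !diamond_arcE /= finset.in_set0.
- by apply: independent_cond_indep; rewrite /indices !inE; vm_compute.
Qed.

End Witness.

Theorem theorem2p4 (R : realType) :
  (forall (d : measure_display) (T : measurableType d) (P : probability T R)
      (p : nat) (d' : 'I_p -> measure_display)
      (V : forall i : 'I_p, measurableType (d' i))
      (X : forall i : 'I_p, {RV P >-> V i}) (Gstar : dag p),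
    markov_property X Gstar -> restricted_faithful X Gstar -> smr X Gstar)
  /\
  (exists (d : measure_display) (T : measurableType d) (P : probability T R)
      (p : nat) (X : forall i : 'I_p, {RV P >-> R}) (Gstar : dag p),
    [/\ markov_property X Gstar, smr X Gstar & ~ restricted_faithful X Gstar]).
Proof.
split=> [d T P p d' V Y G _|]; first exact: restricted_faithful_smr.
exists _, _, (unif R 11), 4%N, (@diamond_rv R), diamond.
split; [exact: diamond_markov|exact: diamond_smr|exact: diamond_not_faithful].
Qed.
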